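(* Let $T$ be a homogeneous tree of degree $q\ge1$, and let $f$ be a finitely supported (or $\ell^1$) function on $V$. There are uncountably many equivalent inversion formulas for the vertex-horospherical Radon transform $\mathcal R_V$, of the form $$f(v)=\sum_{n=-\infty}^{\infty}d_n\int_\Omega \mathcal R_Vf(\mathbf h_n(\omega,v))\,d\nu_v(\omega)\qquad\text{for every }v\in V .$$ Examples of suitable coefficient sequences $(d_n)_{n\in\mathbb Z}$ are $$d_n=\begin{cases}1&n=0,\\ 1-q& n>0\text{ even},\\ 0&\text{otherwise},\end{cases}\qquad\text{and}\qquad d_n=\begin{cases}1& n\le 0\text{ even},\\ 1-q-q^n& n>0\text{ even},\\ 0& n\text{ odd}.\end{cases}$$
   Context: $T$ is a tree in which every vertex has exactly $q+1$ neighbours; $V$ is its set of vertices with graph distance $\operatorname{dist}$. $\Omega$ is the set of ends (equivalence classes of geodesic rays that eventually coincide), $[v,\omega)$ is the ray from $v$ in the class $\omega$, and $\Omega$ has the topology generated by the arcs $\Omega(v,u)=\{\omega:u\in[v,\omega)\}$. The horospherical index is $h(u,v,\omega)=\operatorname{dist}(v,w)-\operatorname{dist}(u,w)$ for any $w$ far enough along $[v,\omega)$, and $\mathbf h_n(\omega,v)=\{u\in V:h(u,v,\omega)=n\}$ is the vertex-horosphere tangent at $\omega$ with index $n$ with respect to $v$. The Radon transform is $\mathcal R_Vf(\mathbf h)=\sum_{u\in\mathbf h}f(u)$. $\nu_v$ is the Borel probability measure on $\Omega$ with $\nu_v(\Omega(v,u))=\frac1{(q+1)q^{k-1}}$ whenever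 $\operatorname{dist}(u,v)=k\ge1$. *)

(* Defs.v *)
From HB Require Import structures.
From mathcomp Require Import all_boot all_order all_algebra finmap.
From mathcomp Require Import generic_quotient.
From mathcomp Require Import complex.
From mathcomp Require Import all_classical all_reals all_analysis.
From mathcomp Require summability.

Set Implicit Arguments.
Unset Strict Implicit.
Unset Printing Implicit Defensive.

Import Order.TTheory GRing.Theory Num.Theory.
Import numFieldNormedType.Exports.

Local Open Scope classical_set_scope.
Local Open Scope card_scope.
Local Open Scope quotient_scope.
Local Open Scope ring_scope.

(* Homogeneous trees of degree q >= 1, i.e. every vertex has q + 1 neighbours. *)
Record homogeneousTree (q : nat) := HomogeneousTree {
  vertex :> choiceType ;
  edge : rel vertex ;
  degree_gt0 : (0 < q)%N ;
  vertex_inhabited : inhabited vertex ;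
  edge_sym : symmetric edge ;
  edge_irr : irreflexive edge ;
  edge_connected : forall x y : vertex, exists2 p, path edge x p & last x p = y ;
  edge_acyclic : forall c : seq vertex, (2 < size c)%N -> ~ ucycle edge c ;
  edge_degree : forall x : vertex, [set y | edge x y] #= `I_q.+1 }.

Section tree.
Context {q : nat} {T : homogeneousTree q}.
Implicit Types (x y z u v : T).

Definition walk x y (n : nat) : bool :=
  `[< exists p, [/\ path (@edge q T) x p, last x p = y & size p = n] >].

Lemma walk_ex x y : exists n, walk x y n.
Proof.
by have [p xp py] := edge_connected x y; exists (size p); apply/asboolP; exists p.
Qed.

Definition dist x y : nat := ex_minn (walk_ex x y).

Lemma distP x y :
  exists p, [/\ path (@edge q T) x p, last x p = y & size p = dist x y].
Proof. by rewrite /dist; case: ex_minnP => n /asboolP. Qed.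

Lemma dist_le x p : path (@edge q T) x p -> (dist x (last x p) <= size p)%N.
Proof.
move=> xp; rewrite /dist; case: ex_minnP => n _; apply.
by apply/asboolP; exists p.
Qed.

Lemma dist_triangle y x z : (dist x z <= dist x y + dist y z)%N.
Proof.
have [p [xp py <-]] := distP x y; have [s [ys sz <-]] := distP y z.
have := @dist_le x (p ++ s); rewrite cat_path last_cat size_cat xp py sz.
exact.
Qed.

Lemma dist_edge x y : edge x y -> (dist x y <= 1)%N.
Proof. by move=> xy; apply: (@dist_le x [:: y]); rewrite /= xy. Qed.

End tree.

Section rays.
Context {q : nat} (T : homogeneousTree q).

Record ray := Ray {
  ray_vertex :> nat -> T ;
  ray_geodesic : forall m n, (m <= n)%N ->
    dist (ray_vertex m) (ray_vertex n) = (n - m)%N }.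

HB.instance Definition _ := gen_eqMixin ray.
HB.instance Definition _ := gen_choiceMixin ray.

Definition cofinal (r s : ray) : bool :=
  `[< exists m n, forall k, r (m + k)%N = s (n + k)%N >].

Lemma cofinal_refl : reflexive cofinal.
Proof. by move=> r; apply/asboolP; exists 0%N, 0%N. Qed.

Lemma cofinal_sym : symmetric cofinal.
Proof.
by move=> r s; apply/asboolP/asboolP => -[m [n rs]]; exists n, m => k; rewrite rs.
Qed.

Lemma cofinal_trans : transitive cofinal.
Proof.
move=> s r t /asboolP[m [n rs]] /asboolP[m' [n' st]]; apply/asboolP.
exists (m + m')%N, (n' + n)%N => k.
by rewrite -addnA rs addnCA st addnA.
Qed.

Canonical cofinal_equiv := EquivRel cofinal cofinal_refl cofinal_sym cofinal_trans.

Definition ends := {eq_quot cofinal}.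

HB.instance Definition _ := Choice.on ends.
HB.instance Definition _ := EqQuotient.on ends.

Lemma path_dist_lt (o y : T) p : path (@edge q T) o p -> last o p = y ->
  size p = dist o y -> forall z, z \in o :: p -> z != y -> (dist o z < dist o y)%N.
Proof.
move=> + + + z zp; case/splitPl: p / zp => p1 p2 <-.
rewrite cat_path last_cat size_cat => /andP[op1 p1p2] p2y <- ny.
apply: (leq_ltn_trans (dist_le op1)).
by case: p2 p2y {p1p2} => [/= zy|a s _]; rewrite ?zy ?eqxx ?addnS ?ltnS ?leq_addr // in ny *.
Qed.

Lemma two_parents (o x y z : T) : edge x y -> edge x z ->
  (dist o y <= dist o x)%N -> (dist o z <= dist o x)%N -> y = z.
Proof.
move=> xy xz dy dz; apply/eqP; apply/negPn/negP => nyz.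
have nx w : edge x w -> x != w.
  by move=> xw; apply/eqP => E; rewrite -E edge_irr in xw.
have avoid w p : edge x w -> (dist o w <= dist o x)%N ->
    path (@edge q T) o p -> last o p = w -> size p = dist o w -> x \notin o :: p.
  move=> xw dw op pw sp; apply/negP => xp.
  by have := path_dist_lt op pw sp xp (nx _ xw); rewrite ltnNge dw.
have [p [op py sp]] := distP o y; have [s [os sz ss]] := distP o z.
have xNp := avoid _ _ xy dy op py sp.
have xNs := avoid _ _ xz dz os sz ss.
have yo : path (@edge q T) y (rev (belast o p)).
  rewrite -py rev_path; rewrite (eq_path (e' := @edge q T)) // => a b.
  by rewrite edge_sym.
have lyo : last y (rev (belast o p)) = o.
  case: p {op sp xNp yo} py => [/= -> //|a t _].
  by rewrite /= rev_cons last_rcons.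
have w : path (@edge q T) y (rev (belast o p) ++ s) by rewrite cat_path yo lyo.
have lw : last y (rev (belast o p) ++ s) = z by rewrite last_cat lyo.
have xNw : x \notin rev (belast o p) ++ s.
  rewrite mem_cat mem_rev negb_or; apply/andP; split.
    by apply: contra xNp => /mem_belast.
  by apply: contra xNs; rewrite inE orbC => ->.
move: lw; case/shortenP: w => c yc uc sub lc.
have xNc : x \notin c by apply: contra xNw => /sub.
apply: (@edge_acyclic q T [:: x, y & c]).
  by case: c lc nyz {yc uc sub xNc} => //= ->; rewrite eqxx.
apply/andP; split.
  by rewrite /= rcons_path xy yc lc edge_sym xz.
by rewrite cons_uniq uc inE negb_or nx // xNc.
Qed.

Lemma neighbour_neq (x y0 : T) : exists2 y, edge x y & y != y0.
Proof.
apply: contrapT => H.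
have sub : [set y | edge x y] `<=` [set y0].
  by move=> y /= xy; apply/eqP; apply/negPn/negP => ny; apply: H; exists y.
have := subset_card_le sub.
rewrite (card_le_eql (edge_degree x)) (card_le_eqr card_set1) card_le_II ltnS.
by rewrite leqNgt degree_gt0.
Qed.

Lemma child_ex (o x : T) : exists2 y, edge x y & dist o y = (dist o x).+1.
Proof.
have [y xy dy] : exists2 y : T, edge x y & (dist o x < dist o y)%N.
  apply: contrapT => H.
  have lex y : edge x y -> (dist o y <= dist o x)%N.
    by move=> xy; rewrite leqNgt; apply/negP => dy; apply: H; exists y.
  have [y xy _] := neighbour_neq x x; have [z xz] := neighbour_neq x y.
  by rewrite (two_parents xy xz (lex _ xy) (lex _ xz)) eqxx.
exists y => //; apply/eqP; rewrite eqn_leq dy andbT.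
by rewrite (leq_trans (dist_triangle x o y)) // -addn1 leq_add2l dist_edge.
Qed.

Lemma ray_ex : exists r : ray, True.
Proof.
case: (vertex_inhabited T) => o.
have /choice[g Hg] : forall x : T, exists y, edge x y /\ dist o y = (dist o x).+1.
  by move=> x; have [y xy dy] := child_ex o x; exists y.
pose r n := iter n g o.
have doo : dist o o = 0%N.
  by apply/eqP; rewrite -leqn0; apply: (@dist_le q T o [::]).
have dr n : dist o (r n) = n.
  by elim: n => [|n IH] //=; have [_ ->] := Hg (r n); rewrite IH.
have dle m k : (dist (r m) (r (m + k)) <= k)%N.
  elim: k => [|k IH]; first by rewrite addn0; apply: (@dist_le q T _ [::]).
  rewrite addnS (leq_trans (dist_triangle (r (m + k)%N) _ _)) // -(addn1 k).
  by rewrite leq_add //; apply: dist_edge; have [] := Hg (r (m + k)%N).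
suff geo m n : (m <= n)%N -> dist (r m) (r n) = (n - m)%N by exists (Ray geo).
move=> mn; apply/eqP; rewrite eqn_leq; apply/andP; split.
  by rewrite -{1}(subnKC mn).
by rewrite leq_subLR; have := dist_triangle (r m) o (r n); rewrite !dr.
Qed.

HB.instance Definition _ :=
  isPointed.Build ends (\pi_(ends) (projT1 (cid ray_ex))).

End rays.

Section boundary.
Context {q : nat} {T : homogeneousTree q}.
Implicit Types (u v : T) (w : ends T) (n : int).

(* [ray_from v w r] says that r is the ray [v, w). *)
Definition ray_from v w (r : ray T) : Prop := r 0%N = v /\ \pi_(ends T) r = w.

Definition end_arc v u : set (ends T) :=
  [set w | exists2 r, ray_from v w r & exists k, r k = u].

HB.instance Definition _ := isSubBaseTopological.Build (ends T)
  [set end_arc vu.1 vu.2 | vu in [set: T * T]] id.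

Definition borel_ends : Type := g_sigma_algebraType (@open (ends T)).
HB.instance Definition _ := Measurable.on borel_ends.

Definition horo_index u v w : int :=
  xget 0 [set n | exists2 r, ray_from v w r &
    \forall k \near \oo, (dist v (r k))%:Z - (dist u (r k))%:Z = n].

Definition horosphere n w v : set T := [set u | horo_index u v w = n].

End boundary.
Arguments borel_ends {q} T.

Section sums.
Context {K : numFieldType}.

(* Limit of the sums over finite subsets of h, directed by inclusion. *)
Definition unordered_sum {I : choiceType} (h : set I) (f : I -> K) : K :=
  lim ((fun F : {fset I} => \sum_(u <- F | u \in h) f u) @
       @summability.totally I).

(* Both halves of the bilateral series converge, with total l. *)
Definition bilateral_sum (a : int -> K) (l : K) : Prop :=
  (fun MN : nat * nat =>
     \sum_(0 <= k < MN.2) a k%:Z + \sum_(0 <= k < MN.1) a (- k.+1%:Z))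
    @ (\oo, \oo) --> l.

End sums.

Section radon.
Context {R : realType} {q : nat} {T : homogeneousTree q}.
Implicit Types (f : T -> R[i]) (v : T) (d : int -> R).

Definition finitely_supported : set (T -> R[i]) :=
  [set f | finite_set [set u | f u != 0]].

Definition ell1 : set (T -> R[i]) :=
  [set f | (\esum_(u in [set: T]) (ComplexField.Normc.normc (f u))%:E < +oo)%E].

Definition radon f (h : set T) : R[i] := unordered_sum h f.

Definition cintegrable (mu : probability (borel_ends T) R)
    (g : borel_ends T -> R[i]) : Prop :=
  mu.-integrable setT (fun w => (complex.Re (g w))%:E) /\
  mu.-integrable setT (fun w => (complex.Im (g w))%:E).

Definition cintegral (mu : probability (borel_ends T) R)
    (g : borel_ends T -> R[i]) : R[i] :=
  Complex (\int[mu]_w complex.Re (g w)) (\int[mu]_w complex.Im (g w)).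

Definition inversion_formula (nu : T -> probability (borel_ends T) R)
    d f : Prop :=
  forall v,
    (forall n, cintegrable (nu v) (fun w => radon f (horosphere n w v))) /\
    bilateral_sum
      (fun n => (d n)%:C%C * cintegral (nu v) (fun w => radon f (horosphere n w v)))
      (f v).

End radon.

Definition horo_coef1 (R : realType) (q : nat) (n : int) : R :=
  if n == 0 then 1
  else if (0 < n) && (2 %| n)%Z then 1 - q%:R
  else 0.

Definition horo_coef2 (R : realType) (q : nat) (n : int) : R :=
  if ~~ (2 %| n)%Z then 0
  else if n <= 0 then 1
  else 1 - q%:R - q%:R ^ n.

(* Main.v *)
Require Import Defs.
From mathcomp Require Import all_boot all_order all_algebra finmap.
From mathcomp Require Import complex.
From mathcomp Require Import all_classical all_reals all_analysis.
From mathcomp Require Import measurable_realfun zify ring lra.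
From mathcomp Require summability.

Set Implicit Arguments.
Unset Strict Implicit.
Unset Printing Implicit Defensive.

Import Order.TTheory GRing.Theory Num.Theory.
Import numFieldNormedType.Exports.
Local Open Scope classical_set_scope.
Local Open Scope ring_scope.

(* Let k = dist(v, u). If [v, w) leaves the segment [v, u] after exactly j steps,
   then h(u, v, w) = 2j - k; under nu_v this has a probability m(k, j) depending
   only on k and j. So the formula holds for every l^1 function as soon as
   sum_j m(k, j) d(2j - k) = [k = 0] while sum_j m(k, j) |d(2j - k)| stays bounded
   in k: approximate f by its restriction to a finite set.
   For the first sequence the identity is Abel summation. The difference e of the
   two sequences satisfies q^n e(-n) = - e(n), whereas q^(2j - k) m(k, j) =
   m(k, k - j), so reversing the sum gives sum_j m(k, j) e(2j - k) = 0. Hence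
   every sequence d1 + t e with t real is suitable. *)

(** * Geodesics and rays *)

Section tree_geometry.
Local Open Scope nat_scope.
Context {q : nat} {T : homogeneousTree q}.
Implicit Types (x y z u v : T) (r s : ray T).

Lemma dist0 x : dist x x = 0.
Proof. by apply/eqP; rewrite -leqn0; apply: (@dist_le q T x [::]). Qed.

Lemma dist_sym x y : dist x y = dist y x.
Proof.
suff le (a b : T) : dist a b <= dist b a by apply/eqP; rewrite eqn_leq !le.
have [p [bp <- <-]] := distP b a; set c := last b p.
have -> : b = last c (rev (belast b p)).
  by rewrite /c; case: p {bp c} => //= h t; rewrite rev_cons last_rcons.
have := @dist_le q T c (rev (belast b p)); rewrite size_rev size_belast; apply.
rewrite /c rev_path (eq_path (e' := @edge q T)) // => i j.
by rewrite edge_sym.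
Qed.

Lemma dist_eq0 x y : (dist x y == 0) = (x == y).
Proof.
apply/eqP/eqP => [d0|->]; last exact: dist0.
have [p [_ py sp]] := distP x y.
by rewrite -py (size0nil (etrans sp d0)).
Qed.

Lemma dist1_edge x y : dist x y = 1 -> edge x y.
Proof. by have [[|a [|b p]] [/= + + <-]] := distP x y => // /andP[+ _] <-. Qed.

(** Induction on two consecutive distances at once: if [f n.+2] were no farther from [f 0] than
    [f n.+1], then [f n] and [f n.+2] would both be parents of [f n.+1], and [two_parents] would
    identify them. *)
Lemma nonbacktracking_dist (f : nat -> T) n :
  (forall i, edge (f i) (f i.+1)) -> (forall i, f i.+2 != f i) ->
  dist (f 0) (f n) = n.
Proof.
move=> fE fN; suff: dist (f 0) (f n) = n /\ dist (f 0) (f n.+1) = n.+1 by case.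
elim: n => [|n [IHn IHn1]].
  split; first exact: dist0.
  apply/eqP; rewrite eqn_leq dist_edge //= lt0n; apply/eqP => d0.
  have [p [_ + sp]] := distP (f 0) (f 1); rewrite d0 in sp.
  by case: p sp => //= _ f01; have := fE 0; rewrite -f01 edge_irr.
split=> //; apply/eqP; rewrite eqn_leq; apply/andP; split.
  have := dist_triangle (f n.+1) (f 0) (f n.+2); have := dist_edge (fE n.+1); lia.
rewrite ltnNge; apply/negP => le; have := fN n; apply/negP; rewrite negbK.
apply/eqP; apply: (@two_parents q T (f 0) (f n.+1)) => //.
- by rewrite edge_sym.
- by rewrite IHn1.
- by rewrite IHn IHn1.
Qed.

Lemma nonbacktracking_ray (f : nat -> T) :
  (forall i, edge (f i) (f i.+1)) -> (forall i, f i.+2 != f i) ->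
  exists r : ray T, r =1 f.
Proof.
move=> fE fN.
have geo m n : m <= n -> dist (f m) (f n) = n - m.
  move=> mn; have := @nonbacktracking_dist (fun i => f (m + i)) (n - m).
  by rewrite addn0 subnKC //; apply => i; rewrite !addnS.
by exists (Ray geo).
Qed.

Lemma ray_edge r i : edge (r i) (r i.+1).
Proof. by apply: dist1_edge; rewrite ray_geodesic // subSnn. Qed.

Lemma ray_dist0 r i : dist (r 0) (r i) = i.
Proof. by rewrite ray_geodesic // subn0. Qed.

Lemma ray_nonbacktracking r i : r i.+2 != r i.
Proof.
apply/eqP => E; have := @ray_geodesic q T r i i.+2 (leqW (leqnSn i)).
by rewrite E dist0; lia.
Qed.

Lemma ray_inj0 r s i j : r 0 = s 0 -> r i = s j -> i = j.
Proof. by move=> rs0 rsij; rewrite -(ray_dist0 r i) rs0 rsij ray_dist0. Qed.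

(** Going down from [m], the predecessors of a common vertex are both its parents with respect to
    the common origin, and parents are unique. *)
Lemma ray_eq_below r s m i : r 0 = s 0 -> r m = s m -> i <= m -> r i = s i.
Proof.
move=> rs0 rsm im; rewrite -(subKn im); elim: (m - i) => [|n IH]; first by rewrite subn0.
case: (leqP m n) => mn; first by rewrite (eqP (_ : m - n.+1 == 0)) // subn_eq0 ltnW.
have E : m - n = (m - n.+1).+1 by lia.
rewrite E in IH.
apply: (@two_parents q T (r 0) (r (m - n.+1).+1)).
- by rewrite edge_sym ray_edge.
- by rewrite IH edge_sym ray_edge.
- by rewrite !ray_dist0.
- by rewrite !ray_dist0 rs0 ray_dist0.
Qed.

(** A geodesic from [v] to [u] is prolonged by steps that move away from [v]; such steps exist
    because no vertex is a leaf. *)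
Lemma ray_through v u : exists2 r : ray T, r 0 = v & r (dist v u) = u.
Proof.
have /choice[g Hg] : forall x : T, exists y, edge x y /\ dist v y = (dist v x).+1.
  by move=> x; have [y xy dy] := child_ex v x; exists y.
have [p [vp pu sp]] := distP v u.
pose f i := if i <= size p then nth v (v :: p) i else iter (i - size p) g u.
have f0 : f 0 = v by [].
have fsz : f (size p) = u by rewrite /f leqnn -last_nth.
have fg i : size p <= i -> f i.+1 = g (f i).
  move=> pi; rewrite /f ltnNge pi /= subSn //.
  case: ltngtP pi => //= <- _; by rewrite subnn -last_nth pu.
have fE i : edge (f i) (f i.+1).
  case: (leqP (size p) i) => ip; first by rewrite fg //; have [] := Hg (f i).
  by rewrite /f ip (ltnW ip); apply: (pathP v vp).
have fd_le i : dist v (f i) <= i.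
  elim: i => [|i IH]; first by rewrite f0 dist0.
  have := dist_triangle (f i) v (f i.+1); have := dist_edge (fE i); lia.
(* The lower bound descends from the end: [f (size p)] is at distance exactly [size p], and one step
   changes the distance by at most 1. *)
have fd_ge k : forall i, i + k = size p -> i <= dist v (f i).
  elim: k => [|k IH] i ik; first by rewrite addn0 in ik; rewrite ik fsz sp.
  have := IH i.+1; rewrite addSnnS ik => /(_ erefl).
  have := dist_triangle (f i) v (f i.+1); have := dist_edge (fE i); lia.
have fd i : dist v (f i) = i.
  case: (leqP i (size p)) => ip.
    by apply/eqP; rewrite eqn_leq fd_le (fd_ge (size p - i)) // subnKC.
  have -> : i = size p + (i - size p) by lia.
  elim: (i - size p) => [|k IH]; first by rewrite addn0 fsz sp.
  rewrite addnS fg ?leq_addr //; have [_ ->] := Hg (f (size p + k)).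
  by rewrite IH.
have [r rf] : exists r : ray T, r =1 f.
  apply: nonbacktracking_ray => // i; apply/eqP => E.
  by have := fd i.+2; rewrite E fd; lia.
by exists r; rewrite rf // -sp fsz.
Qed.

(** If [y] is the next vertex, drop the origin; otherwise prepend [y]. Iterated along a path, this
    bases any end at any vertex. *)
Lemma ray_move r y : edge (r 0) y -> exists2 s : ray T, s 0 = y & cofinal r s.
Proof.
move=> ry; have [E|N] := eqVneq (r 1) y.
  have [s sE] : exists s : ray T, s =1 (fun i => r i.+1).
    by apply: nonbacktracking_ray => i; [apply: ray_edge|apply: ray_nonbacktracking].
  exists s; first by rewrite sE.
  by apply/asboolP; exists 1, 0 => k; rewrite sE.
have [s sE] : exists s : ray T, s =1 (fun i => if i is j.+1 then r j else y).
  apply: nonbacktracking_ray => -[|i]; rewrite ?ray_edge ?ray_nonbacktracking //.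
  by rewrite edge_sym.
exists s; first by rewrite sE.
by apply/asboolP; exists 0, 1 => k; rewrite sE.
Qed.

Lemma ray_from_ex v (w : ends T) : exists r, ray_from v w r.
Proof.
have [p] := edge_connected ((repr w) 0) v.
have : \pi_(ends T)%qT (repr w) = w by rewrite reprK.
elim: p (repr w) => [|y p IH] r rw /=; first by move=> _ rv; exists r.
move=> /andP[ry yp] pv; have [s s0 rs] := ray_move ry.
apply: (IH s); rewrite ?s0 //.
by rewrite -rw; apply/eqP; rewrite eqmodE /= cofinal_sym.
Qed.

(** With a common origin the shift between cofinal rays is zero, since the index of a vertex is its
    distance to the origin; agreement far out then propagates back. *)
Lemma ray_from_unique v (w : ends T) r s :
  ray_from v w r -> ray_from v w s -> r =1 s.
Proof.
move=> [rv rw] [sv sw] i; have rs0 : r 0 = s 0 by rewrite rv.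
have : cofinal r s.
  have /eqP := etrans rw (esym sw); rewrite eqmodE; exact.
move=> /asboolP[m [n rs]].
have E k : r (m + k) = s (m + k).
  by rewrite {2}(ray_inj0 rs0 (rs k)).
by apply: (ray_eq_below (m := m + i)) => //; rewrite leq_addl.
Qed.

(* The reversed segment from s k to s j followed by the tail of r from r j
   does not backtrack, hence is geodesic. *)
Lemma dist_fork r s j k m : r j = s j -> j <= k -> j <= m ->
  (j < k -> r j.+1 != s j.+1) -> dist (s k) (r m) = (k - j) + (m - j).
Proof.
move=> rsj jk jm fork.
pose f i := if i <= k - j then s (k - i) else r (i - (k - j) + j).
have fr i : k - j <= i -> f i = r (i - (k - j) + j).
  rewrite /f; case: ltngtP => // <- _.
  by rewrite subnn add0n subKn.
have fs i : i <= k - j -> f i = s (k - i) by rewrite /f => ->.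
have fE i : edge (f i) (f i.+1).
  case: (leqP (k - j) i) => ki.
    by rewrite !fr ?(leqW ki) // subSn // addSn ray_edge.
  rewrite !fs // ?(ltnW ki) // (_ : k - i = (k - i.+1).+1); last by lia.
  by rewrite edge_sym ray_edge.
have fN i : f i.+2 != f i.
  case: (leqP (k - j) i) => ki.
    by rewrite !fr ?(leqW (leqW ki)) ?(leqW ki) // 2?subSn ?(leqW ki) // !addSn ray_nonbacktracking.
  case: (ltngtP (k - j) i.+1) => ki1; first by lia.
    rewrite !fs // ?(ltnW ki) // (_ : k - i = (k - i.+2).+2); last by lia.
    by rewrite eq_sym ray_nonbacktracking.
  (* At the junction the two neighbours of the branch vertex are [r j.+1] and [s j.+1], distinct by
     [fork]. *)
  rewrite fr ?ki1 // fs ?(ltnW ki) // (_ : k - i = j.+1); last by lia.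
  rewrite subSn // subnn add1n; apply: fork; lia.
have := nonbacktracking_dist ((k - j) + (m - j)) fE fN.
rewrite fs // subn0 fr ?leq_addr //.
by rewrite (_ : k - j + (m - j) - (k - j) + j = m) //; lia.
Qed.

End tree_geometry.

(** * Horospheres and their mass *)

Section horospheres.
Context {q : nat} {T : homogeneousTree q}.
Implicit Types (u v : T) (w : ends T) (r s : ray T).

Lemma end_arc_rayE v w r s i : ray_from v w r -> s 0%N = v ->
  end_arc v (s i) w <-> r i = s i.
Proof.
move=> rw sv; split=> [[r' r'w [k r'k]]|rs]; last by exists r => //; exists i.
have k_i : k = i by apply: ray_inj0 r'k; rewrite sv; case: r'w.
by rewrite -r'k k_i; apply: ray_from_unique rw r'w _.
Qed.

Lemma end_arc_root v : end_arc v v = setT.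
Proof.
apply/seteqP; split=> // w _; have [r rw] := ray_from_ex v w.
by exists r => //; exists 0%N; case: rw.
Qed.

(** For [i >= j] the distances from [r i] to [v] and to [s k] are [i] and [(k - j) + (i - j)]. Their
    difference is constant past the branch point, so [xget] picks this unique eventual value and not
    its default. *)
Lemma horo_indexE v w r s j k : ray_from v w r -> s 0%N = v -> r j = s j ->
  (j <= k)%N -> ((j < k)%N -> r j.+1 != s j.+1) ->
  horo_index (s k) v w = (2 * j)%:Z - k%:Z.
Proof.
move=> rw sv rsj jk fork; rewrite /horo_index.
have E r' : ray_from v w r' -> \forall i \near \oo,
    (dist v (r' i))%:Z - (dist (s k) (r' i))%:Z = (2 * j)%:Z - k%:Z.
  move=> r'w; near=> i.
  have ji : (j <= i)%N by near: i; exact: nbhs_infty_ge.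
  rewrite -(ray_from_unique rw r'w i) (dist_fork rsj jk ji fork).
  by case: rw => <- _; rewrite ray_dist0; lia.
apply: xget_unique => [|n [r' r'w]]; first by exists r => //; apply: E.
move=> H; have [i []] := filter_ex (filterI H (E _ r'w)).
by move=> <-.
Unshelve. all: by end_near. Qed.

Lemma fork_ex r s k : r 0%N = s 0%N -> exists j,
  [/\ (j <= k)%N, r j = s j & (j < k)%N -> r j.+1 != s j.+1].
Proof.
move=> rs0; elim: k => [|k [j [jk rsj fork]]]; first by exists 0%N.
have [rsk|rsk] := eqVneq (r k.+1) (s k.+1); first by exists k.+1; rewrite ltnn.
exists j; split=> //; first exact: leqW.
rewrite ltnS leq_eqVlt => /orP[/eqP->//|]; exact: fork.
Qed.

(** Turns a level set of the index into a difference of two arcs, whose measures are known; [j] is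
    recovered from the index because j -> 2j - k is injective. *)
Lemma horo_index_arc v w s j k : s 0%N = v -> (j <= k)%N ->
  horo_index (s k) v w = (2 * j)%:Z - k%:Z <->
  end_arc v (s j) w /\ ~ ((j < k)%N /\ end_arc v (s j.+1) w).
Proof.
move=> sv jk; have [r rw] := ray_from_ex v w.
have rs0 : r 0%N = s 0%N by rewrite sv; case: rw.
rewrite !(end_arc_rayE _ rw sv).
split=> [H|[rsj Nfork]].
  have [j' [j'k rsj' fork]] := fork_ex k rs0.
  have := horo_indexE rw sv rsj' j'k fork; rewrite H => E.
  have {E} -> : j = j' by lia.
  by split => // -[/fork/eqP].
apply: (horo_indexE rw sv) => // jk'; apply/eqP => E; exact: Nfork.
Qed.

Lemma horo_index_range v w s k : s 0%N = v ->
  exists2 j, (j <= k)%N & horo_index (s k) v w = (2 * j)%:Z - k%:Z.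
Proof.
move=> sv; have [r rw] := ray_from_ex v w.
have rs0 : r 0%N = s 0%N by rewrite sv; case: rw.
have [j [jk rsj fork]] := fork_ex k rs0.
by exists j => //; apply: (horo_indexE rw sv).
Qed.

(** An arc is a subbasic open set: a union of one set, itself an intersection of one arc. *)
Lemma measurable_end_arc v u : measurable (end_arc v u : set (borel_ends T)).
Proof.
apply: sub_sigma_algebra; exists [set end_arc v u]; last by rewrite bigcup_set1.
move=> _ ->; exists [fset end_arc v u]%fset; last by rewrite set_fset1 bigcap_set1.
by move=> A; rewrite !inE => ->; exists (v, u).
Qed.

End horospheres.

(** * Measure of the ends at which a vertex has a given index *)

Section horo_measure.
Context {R : realType}.

(** Measure of the arc of a vertex at distance [j]; for [j = 0] the arc is the whole boundary. *)
Definition arc_mass (q j : nat) : R :=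
  if j is i.+1 then 1 / (q.+1%:R * q%:R ^+ i) else 1.

(* Probability that [v, w) leaves the segment [v, u] of length k after exactly j steps. *)
Definition fork_mass (q k j : nat) : R :=
  arc_mass q j - (if (j < k)%N then arc_mass q j.+1 else 0).

(** At most one [j] contributes. The form as a sum over all [j] allows an exchange with the sum over
    [n]. *)
Definition horo_mass (q k : nat) (n : int) : R :=
  \sum_(j < k.+1) (n == (2 * j)%:Z - k%:Z)%:R * fork_mass q k j.

Context {q : nat} {T : homogeneousTree q}.
Variable nu : T -> probability (borel_ends T) R.
Hypothesis nu_arc : forall (v u : T) (k : nat), (1 <= k)%N -> dist u v = k ->
  nu v (end_arc v u) = (1 / (q.+1%:R * q%:R ^+ k.-1))%:E.

Lemma nu_arc_ray v (s : ray T) j : s 0%N = v ->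
  nu v (end_arc v (s j)) = (arc_mass q j)%:E.
Proof.
move=> sv; case: j => [|j]; first by rewrite sv end_arc_root probability_setT.
by rewrite (nu_arc (k := j.+1)) // dist_sym -sv ray_dist0.
Qed.

(** Either no fork position gives the index [n] and the set is empty, or it is the difference of two
    nested arcs and the measures subtract. *)
Lemma horo_index_preimage (v u : T) (n : int) :
  measurable ([set w | horo_index u v w = n] : set (borel_ends T)) /\
  nu v [set w | horo_index u v w = n] = (horo_mass q (dist v u) n)%:E.
Proof.
have [s sv su] := ray_through v u; set k := dist v u in su *.
have [[j jk nE]|Nn] := pselect (exists2 j, (j <= k)%N & n = (2 * j)%:Z - k%:Z); last first.
  have -> : [set w | horo_index u v w = n] = set0.
    apply/seteqP; split=> // w /= H; apply: Nn.
    by have [j jk] := horo_index_range w k sv; rewrite su H; exists j.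
  split=> //; rewrite measure0 /horo_mass big1 // => i _.
  case: eqP => [E|]; last by rewrite mul0r.
  by case: Nn; exists i => //; rewrite -ltnS.
have -> : [set w | horo_index u v w = n] =
    end_arc v (s j) `\` (if (j < k)%N then end_arc v (s j.+1) else set0).
  apply/seteqP; split=> w /=; rewrite -su nE (horo_index_arc w sv jk);
    case: ifP => _ [? H]; split=> //; try by case.
  by move=> ?; apply: H.
have mB : measurable ((if (j < k)%N then end_arc v (s j.+1) else set0) : set (borel_ends T)).
  by case: ifP => // _; exact: measurable_end_arc.
have mA : measurable (end_arc v (s j) : set (borel_ends T)) by exact: measurable_end_arc.
split; first exact: measurableD.
rewrite measureD //; last by rewrite [ltLHS](nu_arc_ray _ sv) ltry.
have BA : (if (j < k)%N then end_arc v (s j.+1) else set0) `<=` end_arc v (s j).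
  case: ifP => _ w; last by case.
  have [r rw] := ray_from_ex v w.
  have rs0 : r 0%N = s 0%N by rewrite sv; case: rw.
  move=> /(end_arc_rayE _ rw sv) rs; apply/(end_arc_rayE _ rw sv).
  exact: ray_eq_below rs0 rs (leqnSn _).
rewrite (setIidr BA).
have nuB : nu v (if (j < k)%N then end_arc v (s j.+1) else set0) =
    (if (j < k)%N then arc_mass q j.+1 else 0)%:E.
  by case: ifP => _; [exact: nu_arc_ray|rewrite measure0].
transitivity (fork_mass q k j)%:E.
  by rewrite /fork_mass EFinB; congr (_ - _)%E; [exact: nu_arc_ray|exact: nuB].
rewrite /horo_mass.
rewrite (bigD1 (Ordinal (n := k.+1) (m := j) jk)) //= nE eqxx mul1r big1 ?addr0 //.
move=> i; rewrite -val_eqE /= => /eqP ij; case: eqP => [|_]; last by rewrite mul0r.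
by move=> E; case: ij; lia.
Qed.

End horo_measure.

(** * Coefficient sequences *)

Section coefficients.
Context {R : realType} {q : nat}.
Hypothesis q_gt0 : (0 < q)%N.
Local Notation fork_mass := (@fork_mass R q).
Local Notation arc_mass := (@arc_mass R q).
Implicit Types (n : int) (j k l m M N : nat) (t : R).

Let qR_gt0 : (0 : R) < q%:R. Proof. by rewrite ltr0n. Qed.

(** Summation by parts; nothing is subtracted at [j = k], and the boundary term has weight
    [arc_mass 0 = 1]. *)
Lemma fork_mass_Abel k (d : nat -> R) :
  \sum_(j < k.+1) fork_mass k j * d j =
  d 0%N + \sum_(j < k) arc_mass j.+1 * (d j.+1 - d j).
Proof.
rewrite /fork_mass; under eq_bigr do rewrite mulrBl.
rewrite sumrB big_ord_recl big_ord_recr /= ltnn mul0r addr0 mul1r -addrA -sumrB.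
by congr (_ + _); apply: eq_bigr => i _; rewrite ltn_ord mulrBr.
Qed.

Lemma sum_fork_mass k : \sum_(j < k.+1) fork_mass k j = 1.
Proof.
have := fork_mass_Abel k (fun=> 1); under eq_bigr do rewrite mulr1.
by move=> ->; rewrite big1 ?addr0 // => i _; rewrite subrr mulr0.
Qed.

Lemma arc_mass_gt0 j : 0 < arc_mass j.
Proof. by case: j => [|j] //=; rewrite divr_gt0 // mulr_gt0 ?exprn_gt0 // ltr0n. Qed.

Lemma arc_mass_decr j : arc_mass j.+1 <= arc_mass j.
Proof.
have q1 : (1 : R) <= q%:R by rewrite ler1n.
rewrite /arc_mass; case: j => [|j].
  by rewrite expr0 mulr1 ler_pdivrMr ?mul1r ?ler1n // ltr0n.
have gt0 i : 0 < q.+1%:R * q%:R ^+ i :> R by rewrite mulr_gt0 ?exprn_gt0 ?ltr0n.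
by rewrite !mul1r lef_pV2 ?posrE // ler_pM2l ?ltr0n // exprS ler_peMl // exprn_ge0 // ltW.
Qed.

Lemma fork_mass_ge0 k j : 0 <= fork_mass k j.
Proof.
rewrite /fork_mass; case: ifP => _; first by rewrite subr_ge0 arc_mass_decr.
by rewrite subr0 ltW // arc_mass_gt0.
Qed.

(** On a segment of positive length the mass at [j] is c q^(-j), with c = q/(q+1) at the two ends
    and c = (q-1)/(q+1) inside; c is invariant under reversal of the segment. *)
Lemma fork_mass_reflect j l :
  q%:R ^+ j / q%:R ^+ l * fork_mass (j + l) j = fork_mass (j + l) l.
Proof.
have q0 : (q%:R : R) != 0 by rewrite gt_eqF.
have q10 : (q%:R + 1 : R) != 0 by rewrite gt_eqF // addr_gt0.
rewrite /fork_mass (_ : (j < j + l)%N = (0 < l)%N); last by lia.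
rewrite (_ : (l < j + l)%N = (0 < j)%N); last by lia.
rewrite /arc_mass -[q.+1%:R]natr1.
case: j l => [|j] [|l] //=; rewrite ?exprS ?expr0; field;
  by rewrite ?q0 ?q10 ?expf_neq0.
Qed.

Lemma fork_mass_reflect_int j k : (j <= k)%N ->
  q%:R ^ ((2 * j)%:Z - k%:Z) * fork_mass k j = fork_mass k (k - j).
Proof.
move=> jk; have := fork_mass_reflect j (k - j); rewrite subnKC // => <-.
have -> : (2 * j)%:Z - k%:Z = j%:Z - (k - j)%:Z by lia.
by rewrite expfzDr ?gt_eqF // -exprnN.
Qed.

Lemma dvd2_horo j k : (2 %| (2 * j)%:Z - k%:Z)%Z = ~~ odd k.
Proof. by rewrite -dvdn2; lia. Qed.

(** For odd k all indices are odd and the terms vanish. For k = 2(m+1) the coefficients jump by 1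
    between m and m+1 and by -q between m+1 and m+2, so Abel summation leaves
    [arc_mass m.+1 - q * arc_mass m.+2], which is 0. *)
Lemma sum_horo_coef1 k :
  \sum_(j < k.+1) fork_mass k j * horo_coef1 R q ((2 * j)%:Z - k%:Z) = (k == 0)%:R.
Proof.
have [k_odd|k_even] := boolP (odd k).
  rewrite big1 => [|j _]; first by case: k k_odd.
  rewrite /horo_coef1 dvd2_horo k_odd andbF.
  by case: eqP => [E|_]; rewrite ?mulr0 //; have := dvd2_horo j k; rewrite E k_odd dvdz0.
have [m kE] : exists m, k = m.*2 by exists k./2; rewrite even_halfK.
case: m kE => [|m] kE.
  rewrite kE big_ord_recr big_ord0 /= /horo_coef1 /= add0r.
  by rewrite /fork_mass /= subr0 mulr1.
rewrite (fork_mass_Abel k (fun j => horo_coef1 R q ((2 * j)%:Z - k%:Z))).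
have c1 j : horo_coef1 R q ((2 * j)%:Z - k%:Z) =
    if j == m.+1 then 1 else if (m.+1 < j)%N then 1 - q%:R else 0.
  rewrite /horo_coef1 dvd2_horo k_even andbT.
  by do !case: ifP => //; lia.
rewrite c1 /= add0r (eq_bigr (fun j : 'I_k => arc_mass j.+1 * (nat_of_ord j == m)%:R
    - q%:R * (arc_mass j.+1 * (nat_of_ord j == m.+1)%:R))); last first.
  move=> j _; rewrite !c1 eqSS ltnS.
  have [jm|jm|jm] := ltngtP (nat_of_ord j) m;
  have [jm1|jm1|jm1] := ltngtP (nat_of_ord j) m.+1; rewrite /=;
    first [by exfalso; lia | ring].
have delta i (ik : (i < k)%N) :
    \sum_(j < k) arc_mass j.+1 * (nat_of_ord j == i)%:R = arc_mass i.+1.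
  rewrite (bigD1 (Ordinal ik)) //= eqxx mulr1 big1 ?addr0 // => j.
  by rewrite -val_eqE /= => /negPf ->; rewrite mulr0.
rewrite sumrB -mulr_sumr !delta; [|lia|lia].
rewrite (_ : (k == 0) = false); last by lia.
have q0 : (q%:R : R) != 0 by rewrite gt_eqF.
have q10 : (q%:R + 1 : R) != 0 by rewrite gt_eqF // addr_gt0.
rewrite /arc_mass -[q.+1%:R]natr1 exprS /=; field.
by rewrite q0 q10 expf_neq0.
Qed.

Definition horo_diff n : R := horo_coef2 R q n - horo_coef1 R q n.

Lemma horo_diffE n : horo_diff n =
  if (2 %| n)%Z then (if n < 0 then 1 else if n == 0 then 0 else - q%:R ^ n) else 0.
Proof.
rewrite /horo_diff /horo_coef2 /horo_coef1.
have [-> /=|n0] := eqVneq n 0; first by rewrite subrr.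
case: (2 %| n)%Z; rewrite ?andbF ?subrr //= andbT.
by case: ltgtP n0 => // _ _; rewrite ?subr0 //; ring.
Qed.

Lemma horo_diff_reflect n : q%:R ^ n * horo_diff (- n) = - horo_diff n.
Proof.
have q0 : (q%:R : R) != 0 by rewrite gt_eqF.
rewrite !horo_diffE (_ : (2 %| - n)%Z = (2 %| n)%Z) ?oppr_lt0 ?oppr_eq0; last by lia.
case: (2 %| n)%Z; last by rewrite mulr0 oppr0.
case: ltgtP => n0; rewrite ?mulr1 ?opprK ?mulr0 ?oppr0 //.
by rewrite mulrN -expfzDr // subrr expr0z.
Qed.

(* Reflection pairs the fork at distance j with the one at distance k - j,
   and horo_diff is odd for this pairing. *)
Lemma sum_horo_diff k :
  \sum_(j < k.+1) fork_mass k j * horo_diff ((2 * j)%:Z - k%:Z) = 0.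
Proof.
set S := \sum_(_ < _) _; suff : S = - S by lra.
rewrite {1}/S (reindex_inj rev_ord_inj) /= -sumrN; apply: eq_bigr => j _.
have jk : (j <= k)%N by rewrite -ltnS.
rewrite subSS -fork_mass_reflect_int // mulrAC -mulrN mulrC; congr (_ * _).
rewrite -horo_diff_reflect; congr (_ * horo_diff _); lia.
Qed.

(** By reflection the weight q^n merely permutes the masses. This controls the coefficients that
    grow like q^n. *)
Lemma sum_fork_mass_exp k :
  \sum_(j < k.+1) fork_mass k j * q%:R ^ ((2 * j)%:Z - k%:Z) = 1.
Proof.
rewrite -[RHS](sum_fork_mass k) [RHS](reindex_inj rev_ord_inj) /=; apply: eq_bigr => j _.
by rewrite mulrC subSS fork_mass_reflect_int // -ltnS.
Qed.

Definition horo_family t n : R := horo_coef1 R q n + t * horo_diff n.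

Lemma horo_family0 : horo_family 0 = horo_coef1 R q.
Proof. by apply/funext => n; rewrite /horo_family mul0r addr0. Qed.

Lemma horo_family1 : horo_family 1 = horo_coef2 R q.
Proof. by apply/funext => n; rewrite /horo_family /horo_diff; ring. Qed.

Lemma horo_family_inj : injective horo_family.
Proof.
(* At index -2 the first sequence is 0 and the difference is 1, so the coefficient there is the
   parameter itself. *)
move=> t t' /(congr1 (fun d => d (- 2%:Z))).
by rewrite /horo_family horo_diffE /= !mulr1; lra.
Qed.

Lemma sum_horo_family t k :
  \sum_(j < k.+1) fork_mass k j * horo_family t ((2 * j)%:Z - k%:Z) = (k == 0)%:R.
Proof.
under eq_bigr do rewrite mulrDr mulrCA.
by rewrite big_split /= -mulr_sumr sum_horo_diff mulr0 addr0 sum_horo_coef1.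
Qed.

(** The majorant is built from 1 and q^n because each of them has mean 1 under [fork_mass], for
    every k. *)
Lemma horo_family_le t n : `|horo_family t n| <= 1 + q%:R + `|t| * (1 + q%:R ^ n).
Proof.
have qn : 0 < (q%:R : R) ^ n by rewrite exprz_gt0.
apply: (le_trans (ler_normD _ _)); rewrite normrM lerD //.
  rewrite /horo_coef1; case: ifP => _; first by rewrite normr1; have := qR_gt0; lra.
  case: ifP => _; last by rewrite normr0; have := qR_gt0; lra.
  by rewrite ler_norml; apply/andP; split; have := qR_gt0; lra.
rewrite ler_wpM2l //.
by rewrite horo_diffE; do !case: ifP => _; rewrite ?normr0 ?normr1 ?normrN ?gtr0_norm; lra.
Qed.

Lemma sum_horo_family_le t k :
  \sum_(j < k.+1) fork_mass k j * `|horo_family t ((2 * j)%:Z - k%:Z)|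
  <= 1 + q%:R + `|t| * 2.
Proof.
apply: (@le_trans _ _ (\sum_(j < k.+1) ((1 + q%:R) * fork_mass k j +
    `|t| * (fork_mass k j + fork_mass k j * q%:R ^ ((2 * j)%:Z - k%:Z))))).
  apply: ler_sum => j _.
  apply: (le_trans (ler_wpM2l (fork_mass_ge0 _ _) (horo_family_le _ _))).
  by rewrite le_eqVlt; apply/orP; left; apply/eqP; ring.
rewrite big_split /= -!mulr_sumr sum_fork_mass big_split /= sum_fork_mass sum_fork_mass_exp.
by rewrite mulr1.
Qed.

(** The negative half starts at -1, so the two halves together cover the window -M <= n < N once. *)
Lemma bilateral_delta (d : int -> R) n M N :
  \sum_(0 <= i < N) d i%:Z * (i%:Z == n)%:R +
  \sum_(0 <= i < M) d (- i.+1%:Z) * (- i.+1%:Z == n)%:R =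
  d n * ((- M%:Z <= n) && (n < N%:Z))%:R.
Proof.
have delta (a : nat -> R) m K :
    \sum_(0 <= i < K) a i * (i == m)%:R = a m * (m < K)%:R.
  elim: K => [|K IH]; first by rewrite big_geq // mulr0.
  rewrite big_nat_recr //= IH; have [<-|Km] := eqVneq K m.
    by rewrite ltnn leqnn mulr0 add0r.
  by rewrite ltnS (leq_eqVlt m) eq_sym (negPf Km) mulr0 addr0.
case: n => m.
  rewrite [X in _ + X]big1 => [|i _]; last by rewrite (_ : (_ == _) = false) ?mulr0 //; lia.
  rewrite addr0 (_ : _ && _ = (m < N)%N); last by lia.
  rewrite -[RHS](delta (fun i => d i%:Z)); apply: eq_bigr => i _.
  by congr (_ * _%:R); lia.
rewrite big1 ?add0r => [|i _]; last by rewrite (_ : (_ == _) = false) ?mulr0 //; lia.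
transitivity (\sum_(0 <= i < M) d (- i.+1%:Z) * (i == m)%:R).
  by apply: eq_bigr => i _; congr (_ * _%:R); lia.
by rewrite (delta (fun i => d (- i.+1%:Z))) NegzE; congr (_ * _%:R); lia.
Qed.

(** Weight with which a vertex at distance [k] enters the truncated inversion series. *)
Definition bilateral_mass (d : int -> R) k M N : R :=
  \sum_(0 <= i < N) d i%:Z * horo_mass q k i%:Z +
  \sum_(0 <= i < M) d (- i.+1%:Z) * horo_mass q k (- i.+1%:Z).

Lemma bilateral_massE (d : int -> R) k M N : bilateral_mass d k M N =
  \sum_(j < k.+1) fork_mass k j * (d ((2 * j)%:Z - k%:Z) *
    ((- M%:Z <= (2 * j)%:Z - k%:Z) && ((2 * j)%:Z - k%:Z < N%:Z))%:R).
Proof.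
under [RHS]eq_bigr do rewrite -bilateral_delta mulrDr !mulr_sumr.
rewrite big_split /= /bilateral_mass; congr (_ + _).
  rewrite exchange_big; apply: eq_bigr => i _; rewrite /horo_mass mulr_sumr.
  by apply: eq_bigr => j _; ring.
rewrite exchange_big; apply: eq_bigr => i _; rewrite /horo_mass mulr_sumr.
by apply: eq_bigr => j _; ring.
Qed.

(** All indices lie between -k and k, so the window cuts nothing off. *)
Lemma bilateral_mass_family t k M N : (k <= M)%N -> (k < N)%N ->
  bilateral_mass (horo_family t) k M N = (k == 0)%:R.
Proof.
move=> kM kN; rewrite bilateral_massE -(sum_horo_family t); apply: eq_bigr => j _.
have jk := ltn_ord j.
by rewrite (_ : _ && _) ?mulr1 //; lia.
Qed.

(** Truncation only drops terms, so the bound on absolute values is uniform in k, M and N; it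
    handles vertices too far away for the window. *)
Lemma bilateral_mass_family_le t k M N :
  `|bilateral_mass (horo_family t) k M N| <= 1 + q%:R + `|t| * 2.
Proof.
rewrite bilateral_massE; apply: le_trans (sum_horo_family_le t k).
apply: (le_trans (ler_norm_sum _ _ _)); apply: ler_sum => j _.
rewrite 2!normrM (ger0_norm (fork_mass_ge0 _ _)) ler_wpM2l ?fork_mass_ge0 //.
by case: (_ && _); rewrite ?normr1 ?normr0 ?mulr1 ?mulr0.
Qed.

End coefficients.

(** * Unordered sums *)

Section unordered_sums.
Context {R : realType} {I : choiceType}.
Implicit Types (a h : I -> R) (A B F : {fset I}) (e : R).

(** Smallness of the mass outside [A], tested on finite sums only. *)
Definition tail_le a A e := forall F, \sum_(i <- F | i \notin A) a i <= e.

Lemma sum_fset_split h A F : (A `<=` F)%fset ->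
  \sum_(i <- F) h i = \sum_(i <- A) h i + \sum_(i <- F | i \notin A) h i.
Proof.
move=> AF; rewrite (bigID (mem A)) /=; congr (_ + _).
rewrite big_fset_condE; apply: eq_fbigl => i; rewrite !inE /=.
by case: (boolP (i \in A)) => [/(fsubsetP AF) ->|_]; rewrite ?andbF.
Qed.

Lemma tail_le_sub a A B e : (forall i, 0 <= a i) -> (A `<=` B)%fset ->
  tail_le a A e -> tail_le a B e.
Proof.
move=> a0 AB aA F; apply: le_trans (aA F).
rewrite big_mkcond [leRHS]big_mkcond /=; apply: ler_sum => i _.
case: ifP => iB; case: ifP => // /negbFE iA.
by rewrite (fsubsetP AB _ iA) in iB.
Qed.

(** Take [A] with sum within [e] of the supremum: adjoining any finite set to it gains at most
    [e]. *)
Lemma esum_tail a : (forall i, 0 <= a i) ->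
  (\esum_(i in [set: I]) (a i)%:E < +oo)%E ->
  forall e, 0 < e -> exists A, tail_le a A e.
Proof.
move=> a0 afin e e0.
have fin : \esum_(i in [set: I]) (a i)%:E \is a fin_num.
  by rewrite ge0_fin_numE //; apply: esum_ge0 => i _; rewrite lee_fin.
have sumE F : (\sum_(i \in [set` F]) (a i)%:E = (\sum_(i <- F) a i)%:E)%E.
  by rewrite fsbig_finite // set_fsetK sumEFin.
have ub F : ((\sum_(i <- F) a i)%:E <= \esum_(i in [set: I]) (a i)%:E)%E.
  by apply: ereal_sup_ubound; exists [set` F]; rewrite ?sumE //; split.
have [_ [S [Sfin _] <-]] := ub_ereal_sup_adherent e0 fin.
rewrite -(fset_setK Sfin) sumE; set A := fset_set S => lt.
exists A => F; have := ub (A `|` F)%fset.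
move: lt; rewrite -/(esum _ _) -(fineK fin) -EFinB lte_fin lee_fin => lt.
rewrite (sum_fset_split _ (fsubsetUl A F)) => le.
suff : \sum_(i <- F | i \notin A) a i <= \sum_(i <- (A `|` F)%fset | i \notin A) a i by lra.
rewrite big_mkcond [leRHS]big_mkcond /= (sum_fset_split _ (fsubsetUr A F)) lerDl.
by apply: sumr_ge0 => i _; case: ifP.
Qed.

Lemma norm_sum_tail_le a h A F e : tail_le a A e -> (forall i, `|h i| <= a i) ->
  (A `<=` F)%fset -> `|\sum_(i <- F) h i - \sum_(i <- A) h i| <= e.
Proof.
move=> aA ha AF; rewrite (sum_fset_split _ AF) addrAC subrr add0r.
apply: le_trans (aA F); apply: (le_trans (ler_norm_sum _ _ _)).
exact: ler_sum.
Qed.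

(** The tail bound makes the net of finite sums Cauchy, and passes to the limit because closed balls
    are closed. *)
Lemma net_sum_cvg a h : (forall e, 0 < e -> exists A, tail_le a A e) ->
  (forall i, `|h i| <= a i) ->
  exists2 l : R, (fun F : {fset I} => \sum_(i <- F) h i) @ @summability.totally I --> l
    & forall A e, tail_le a A e -> `|l - \sum_(i <- A) h i| <= e.
Proof.
move=> tl ha.
have PF : ProperFilter (@summability.totally I) by exact: summability.totally_filter.
have near_sub A : \forall F \near @summability.totally I, (A `<=` F)%fset by exists A.
have cv : cvg ((fun F : {fset I} => \sum_(i <- F) h i) @ @summability.totally I).
  apply/cauchy_cvgP/cauchy_exP => e e0.
  have [A aA] := tl (e / 2) (divr_gt0 e0 (ltr0Sn _ 1)).
  exists (\sum_(i <- A) h i); rewrite /= !nbhs_simpl /=; near=> F.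
  rewrite /ball /= distrC; apply: le_lt_trans (_ : e / 2 < e); last by lra.
  by apply: norm_sum_tail_le aA ha _; near: F; exact: near_sub.
exists (lim ((fun F : {fset I} => \sum_(i <- F) h i) @ @summability.totally I)) => //.
move=> A e aA; apply: (@closed_cvg _ _ _ PF (fun F : {fset I} => \sum_(i <- F) h i)
  (fun x => `|x - \sum_(i <- A) h i| <= e)).
- rewrite (_ : (fun x => _) = closed_ball_ Num.norm (\sum_(i <- A) h i) e).
    exact: closed_closed_ball_.
  by apply/funext => x; rewrite /closed_ball_ /= distrC.
- near=> F; apply: norm_sum_tail_le aA ha _; near: F; exact: near_sub.
- exact: cv.
Unshelve. all: by end_near. Qed.

End unordered_sums.

(** * Reduction of complex limits to real and imaginary parts *)

Section complex_limits.
Context {R : realType}.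
Implicit Types z : R[i].

Lemma Re_sum (J : Type) (s : seq J) (P : pred J) (f : J -> R[i]) :
  complex.Re (\sum_(j <- s | P j) f j) = \sum_(j <- s | P j) complex.Re (f j).
Proof. by apply: big_morph => // -[? ?] [? ?]. Qed.

Lemma Im_sum (J : Type) (s : seq J) (P : pred J) (f : J -> R[i]) :
  complex.Im (\sum_(j <- s | P j) f j) = \sum_(j <- s | P j) complex.Im (f j).
Proof. by apply: big_morph => // -[? ?] [? ?]. Qed.

Lemma Re_real_mul (x : R) z : complex.Re (x%:C%C * z) = x * complex.Re z.
Proof. by case: z => a b /=; rewrite mul0r subr0. Qed.

Lemma Im_real_mul (x : R) z : complex.Im (x%:C%C * z) = x * complex.Im z.
Proof. by case: z => a b /=; rewrite mul0r addr0. Qed.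

Lemma norm_Re_le z : `|complex.Re z| <= ComplexField.Normc.normc z.
Proof.
by case: z => a b /=; rewrite -sqrtr_sqr ler_sqrt ?lerDl ?addr_ge0 ?sqr_ge0.
Qed.

Lemma norm_Im_le z : `|complex.Im z| <= ComplexField.Normc.normc z.
Proof.
by case: z => a b /=; rewrite -sqrtr_sqr ler_sqrt ?lerDr ?addr_ge0 ?sqr_ge0.
Qed.

Lemma norm_complex_le z :
  `|z| <= (`|complex.Re z| + `|complex.Im z|)%:C%C.
Proof.
rewrite normc_def lecR -[leRHS]ger0_norm ?addr_ge0 // -sqrtr_sqr.
rewrite ler_sqrt ?sqr_ge0 // sqrrD !real_normK ?num_real //.
by rewrite addrAC lerDl mulrn_wge0 // mulr_ge0.
Qed.

Lemma cvg_complex (U : Type) (F : set_system U) (FF : Filter F)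
    (g : U -> (R[i] : numFieldType)) (z : (R[i] : numFieldType)) :
  (fun x => complex.Re (g x)) @ F --> complex.Re z ->
  (fun x => complex.Im (g x)) @ F --> complex.Im z -> g @ F --> z.
Proof.
move=> /cvgrPdist_lt gRe /cvgrPdist_lt gIm.
apply/cvgrPdist_lt => -[e e'].
(* In the order of [R[i]] a positive tolerance has imaginary part zero. *)
rewrite ltcE /= => /andP[/eqP e'0 e0]; rewrite {}e'0.
have e20 : 0 < e / 2 by rewrite divr_gt0.
near=> x.
apply: le_lt_trans (norm_complex_le _) _.
rewrite ltcE /= eqxx /= (splitr e) ltrD //.
  have -> : complex.Re (z - g x) = complex.Re z - complex.Re (g x) by case: (z) (g x) => ? ? [].
  by near: x; exact: gRe.
have -> : complex.Im (z - g x) = complex.Im z - complex.Im (g x) by case: (z) (g x) => ? ? [].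
by near: x; exact: gIm.
Unshelve. all: by end_near. Qed.

End complex_limits.

(** * Integrals of the Radon transform *)

(** Restriction to [A] only lowers absolute values, so one tail estimate for [f] serves all sets
    [A]; this uniformity lets the bound pass under the integral. *)
Lemma radon_approx (R : realType) (q : nat) (T : homogeneousTree q) (f : T -> R[i])
    (A : set T) :
  (forall e, 0 < e -> exists B, tail_le (fun u => ComplexField.Normc.normc (f u)) B e) ->
  forall B e, tail_le (fun u => ComplexField.Normc.normc (f u)) B e ->
  `|complex.Re (radon f A) - \sum_(u <- B) complex.Re (f u) * (u \in A)%:R| <= e /\
  `|complex.Im (radon f A) - \sum_(u <- B) complex.Im (f u) * (u \in A)%:R| <= e.
Proof.
move=> tl.
have ReA u : `|complex.Re (f u) * (u \in A)%:R| <= ComplexField.Normc.normc (f u).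
  apply: le_trans (norm_Re_le _).
  by case: (u \in A); rewrite ?mulr1 ?mulr0 ?normr0.
have ImA u : `|complex.Im (f u) * (u \in A)%:R| <= ComplexField.Normc.normc (f u).
  apply: le_trans (norm_Im_le _).
  by case: (u \in A); rewrite ?mulr1 ?mulr0 ?normr0.
have [lr lrP lrB] := net_sum_cvg tl ReA; have [li liP liB] := net_sum_cvg tl ImA.
suff -> : radon f A = Complex lr li by move=> B e tB; split; [exact: lrB|exact: liB].
have PF : ProperFilter (@summability.totally T) by exact: summability.totally_filter.
apply: (@cvg_lim (R[i] : numFieldType)); first exact: norm_hausdorff.
have mkc (c : T -> R) F : \sum_(u <- F | u \in A) c u = \sum_(u <- F) c u * (u \in A)%:R.
  rewrite big_mkcond; apply: eq_bigr => u _.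
  by case: (u \in A); rewrite ?mulr1 ?mulr0.
apply: cvg_complex => /=.
  by under eq_fun do rewrite Re_sum mkc.
by under eq_fun do rewrite Im_sum mkc.
Qed.

Section inversion.
Context {R : realType} {q : nat} {T : homogeneousTree q}.
Variable nu : T -> probability (borel_ends T) R.
Hypothesis nu_arc : forall (v u : T) (k : nat), (1 <= k)%N -> dist u v = k ->
  nu v (end_arc v u) = (1 / (q.+1%:R * q%:R ^+ k.-1))%:E.
Implicit Types (v u : T) (n : int) (a g : T -> R).

Local Notation in_horo n v u w := (u \in horosphere n w v).

Lemma in_horoE n v u (w : ends T) :
  in_horo n v u w = (w \in [set w' | horo_index u v w' = n]).
Proof. by apply/idP/idP; rewrite !inE. Qed.

Lemma integral_horo_sum v n g (s : seq T) :
  (nu v).-integrable setT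
    (EFin \o (fun w : borel_ends T => \sum_(u <- s) g u * (in_horo n v u w)%:R)) /\
  \int[nu v]_w (\sum_(u <- s) g u * (in_horo n v u w)%:R) =
  \sum_(u <- s) g u * horo_mass q (dist v u) n.
Proof.
have ind u : (nu v).-integrable setT
      (EFin \o (fun w : borel_ends T => (in_horo n v u w)%:R)) /\
    \int[nu v]_(w in setT) ((in_horo n v u w)%:R) = horo_mass q (dist v u) n.
  have [mH nuH] := horo_index_preimage nu_arc v u n.
  have E : (fun w : borel_ends T => (in_horo n v u w)%:R) =
      \1_[set w | horo_index u v w = n] :> (_ -> R).
    by apply/funext => w; rewrite in_horoE.
  rewrite E; split; first exact: integrable_indic.
  by rewrite /Rintegral integral_indic // setIT [X in fine X]nuH.
have indg u : (nu v).-integrable setT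
      (EFin \o (fun w : borel_ends T => g u * (in_horo n v u w)%:R)).
  by have := @integrableZl _ _ _ (nu v) setT measurableT (g u) _ (ind u).1.
elim: s => [|u s [IHi IHe]].
  have E : (fun w : borel_ends T => \sum_(u <- [::]) g u * (in_horo n v u w)%:R) = cst 0.
    by apply/funext => w; rewrite big_nil.
  rewrite E big_nil; split; first exact: integrable0.
  by rewrite Rintegral_cst // mul0r.
have E : (fun w : borel_ends T => \sum_(u' <- u :: s) g u' * (in_horo n v u' w)%:R) =
    (fun w : borel_ends T => g u * (in_horo n v u w)%:R
      + \sum_(u' <- s) g u' * (in_horo n v u' w)%:R).
  by apply/funext => w; rewrite big_cons.
rewrite E; split.
  by have := integrableD measurableT (indg u) IHi.
rewrite RintegralD // IHe big_cons RintegralZl //; last exact: (ind u).1.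
by rewrite (ind u).2.
Qed.

(** [X] is a uniform limit of finite combinations of indicators. It is integrable since it differs
    from one of them by a bounded function, and the error survives integration because the total
    mass is 1. *)
Lemma integral_horo_limit v n a g (X : ends T -> R) :
  (forall e, 0 < e -> exists B, tail_le a B e) ->
  (forall w B e, tail_le a B e ->
     `|X w - \sum_(u <- B) g u * (in_horo n v u w)%:R| <= e) ->
  (nu v).-integrable setT (fun w => (X w)%:E) /\
  forall B e, tail_le a B e ->
    `|\int[nu v]_w X w - \sum_(u <- B) g u * horo_mass q (dist v u) n| <= e.
Proof.
move=> tl XP.
pose XB (B : {fset T}) (w : borel_ends T) : R := \sum_(u <- B) g u * (in_horo n v u w)%:R.
have XBi (B : {fset T}) : (nu v).-integrable setT (EFin \o XB B).
  exact: (integral_horo_sum v n g B).1.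
have XBm (B : {fset T}) : measurable_fun setT (XB B).
  by apply/measurable_EFinP; exact: measurable_int (XBi B).
(* Measurability passes to limits of sequences, so a sequence is extracted from the net of finite
   sets. *)
have /choice[Bs BsP] : forall m : nat, exists B, tail_le a B m.+1%:R^-1.
  by move=> m; apply: tl; rewrite invr_gt0.
have Xm : measurable_fun setT (X : borel_ends T -> R).
  apply: (@measurable_fun_cvg _ _ _ _ (fun m => XB (Bs m))) => // w _.
  apply/cvgrPdist_lt => e e0; near=> m.
  apply: le_lt_trans (XP w _ _ (BsP m)) _.
  by near: m; exact: near_infty_natSinv_lt (PosNum e0).
have Xi : (nu v).-integrable setT (fun w : borel_ends T => (X w)%:E).
  have [B tB] := tl 1 ltr01.
  have Di : (nu v).-integrable setT (EFin \o (fun w : borel_ends T => X w - XB B w)).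
    apply: measurable_bounded_integrable => //.
    - by rewrite [ltLHS]probability_setT ltry.
    - exact: measurable_funB.
    - exists 1; split; rewrite ?num_real // => M M1 w _ /=.
      exact: le_trans (XP w _ _ tB) (ltW M1).
  have := integrableD measurableT Di (XBi B).
  apply: eq_integrable => // w _ /=.
  by rewrite -EFinD subrK.
split=> // B e tB.
rewrite -(integral_horo_sum v n g B).2 -RintegralB //; last exact: XBi.
have Di : (nu v).-integrable setT (EFin \o (fun w : borel_ends T => X w - XB B w)).
  by have := integrableB measurableT Xi (XBi B).
apply: le_trans (le_normr_Rintegral _ Di) _ => //.
apply: (@le_trans _ _ (\int[nu v]_(w in setT) e)); last first.
  by rewrite Rintegral_cst // [X in fine X]probability_setT mulr1.
apply: le_Rintegral => //.
- exact: integrable_norm Di.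
- apply: measurable_bounded_integrable => //.
  + by rewrite [ltLHS]probability_setT ltry.
  + exact: bounded_cst.
- by move=> w _; exact: XP.
Unshelve. all: by end_near. Qed.

End inversion.

(** * Inversion *)

Section bilateral.
Context {R : realType} {q : nat} {T : homogeneousTree q}.
Implicit Types (v u : T) (t : R) (M N : nat) (c d : int -> R).

Definition partial_bilateral c M N : R :=
  \sum_(0 <= k < N) c k%:Z + \sum_(0 <= k < M) c (- k.+1%:Z).

Lemma partial_bilateral_dist c c' d M N (e : R) :
  (forall n, `|c n - c' n| <= e) ->
  `|partial_bilateral (fun n => d n * c n) M N
    - partial_bilateral (fun n => d n * c' n) M N|
  <= partial_bilateral (fun n => `|d n|) M N * e.
Proof.
move=> cc'; have le n : `|d n * c n - d n * c' n| <= `|d n| * e.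
  by rewrite -mulrBr normrM ler_wpM2l.
rewrite /partial_bilateral opprD addrACA -!sumrB mulrDl !mulr_suml.
apply: (le_trans (ler_normD _ _)).
by apply: lerD; apply: (le_trans (ler_norm_sum _ _ _)); apply: ler_sum.
Qed.

Lemma partial_bilateral_horo_mass v (g : T -> R) (s : seq T) d M N :
  partial_bilateral (fun n => d n * \sum_(u <- s) g u * horo_mass q (dist v u) n) M N
  = \sum_(u <- s) g u * bilateral_mass (q := q) d (dist v u) M N.
Proof.
rewrite /partial_bilateral /bilateral_mass.
under [RHS]eq_bigr do rewrite mulrDr !mulr_sumr.
rewrite big_split /=; congr (_ + _); rewrite exchange_big /=;
  by apply: eq_bigr => k _; rewrite mulr_sumr; apply: eq_bigr => u _; rewrite mulrCA.
Qed.

(** The order of choices matters: first [B0] with small tail, then M and N beyond all distances to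
    [B0], and only then [B]. On [B0] the weights are exact; outside it they differ from the limit
    weights by at most C + 1. *)
Lemma bilateral_cvg v t (a g : T -> R) c :
  (forall u, `|g u| <= a u) ->
  (forall e, 0 < e -> exists B, tail_le a B e) ->
  (forall n B e, tail_le a B e ->
     `|c n - \sum_(u <- B) g u * horo_mass q (dist v u) n| <= e) ->
  (fun MN : nat * nat =>
     partial_bilateral (fun n => horo_family (q := q) t n * c n) MN.1 MN.2)
    @ (\oo, \oo) --> g v.
Proof.
move=> ga tl cP; set d := horo_family t.
have a0 u : 0 <= a u by exact: le_trans (ga u).
have q0 := degree_gt0 T.
pose C : R := 1 + q%:R + `|t| * 2.
have C0 : 0 < C by rewrite /C ltr_wpDr ?mulr_ge0 // ltr_wpDr.
apply/cvgrPdist_le => e e0.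
have e10 : 0 < e / 2 / (C + 1) by rewrite !divr_gt0 // addr_gt0.
have [B0 tB0] := tl _ e10.
pose D := \max_(u <- B0) dist v u.
near=> MN.
have DM : (D < MN.1)%N by near: MN; apply: (cvg_fst (nbhs_infty_gt D)).
have DN : (D < MN.2)%N by near: MN; apply: (cvg_snd (nbhs_infty_gt D)).
move: MN.1 MN.2 DM DN => M N DM DN.
(* [K] may grow with the window, so the set [B1] that absorbs it is chosen after M and N. *)
pose K : R := partial_bilateral (fun n => `|d n|) M N.
have K0 : 0 <= K by rewrite addr_ge0 // sumr_ge0.
have e20 : 0 < e / 2 / (K + 1) by rewrite !divr_gt0 // ltr_wpDl.
have [B1 tB1] := tl _ e20.
(* Including [v] makes [g v] a term of the sum over [B]. *)
pose B := (v |` (B0 `|` B1))%fset.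
have B0B : (B0 `<=` B)%fset by rewrite fsubsetU // orbC fsubsetUl.
have tB : tail_le a B (e / 2 / (K + 1)).
  by apply: tail_le_sub tB1 => //; rewrite fsubsetU // orbC fsubsetUr.
have := partial_bilateral_dist d M N (fun n => cP n B _ tB).
rewrite partial_bilateral_horo_mass -/K.
set P := partial_bilateral _ _ _; set S := \sum_(u <- B) _ => PS.
suff Sg : `|g v - S| <= e / 2.
  rewrite (_ : g v - P = (g v - S) - (P - S)); last by ring.
  rewrite (splitr e); apply: (le_trans (ler_normB _ _)); apply: lerD => //.
  apply: le_trans PS _; rewrite mulrCA ler_piMr ?divr_ge0 ?ltW //.
  by rewrite ltr_pdivrMr ?ltr_wpDl // mul1r ltrDl.
have -> : g v = \sum_(u <- B) g u * (dist v u == 0%N)%:R.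
  rewrite (big_fsetD1 v) /=; last by rewrite !inE eqxx.
  rewrite dist0 eqxx mulr1 big_seq big1 ?addr0 // => u.
  by rewrite !inE dist_eq0 eq_sym => /andP[/negPf -> _]; rewrite mulr0.
rewrite -sumrB (sum_fset_split _ B0B) big_seq big1 ?add0r => [|u uB0]; last first.
  have uD : (dist v u <= D)%N by apply: leq_bigmax_seq.
  by rewrite bilateral_mass_family ?subrr //; [lia|lia].
apply: (le_trans (ler_norm_sum _ _ _)).
apply: (@le_trans _ _ (\sum_(u <- B | u \notin B0) (C + 1) * a u)).
  apply: ler_sum => u _; rewrite -mulrBr normrM mulrC ler_pM //.
  apply: (le_trans (ler_normB _ _)); rewrite addrC lerD ?bilateral_mass_family_le //.
  by case: eqP; rewrite ?normr1 ?normr0.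
rewrite -mulr_sumr; apply: (le_trans (ler_wpM2l _ (tB0 B))); first by rewrite addr_ge0 // ltW.
by rewrite mulrC divfK // gt_eqF // addr_gt0.
Unshelve. all: by end_near. Qed.

End bilateral.

(** Real and imaginary parts are inverted separately, with the modulus of [f] as common majorant. *)
Lemma inversion_ell1 (R : realType) (q : nat) (T : homogeneousTree q)
    (nu : T -> probability (borel_ends T) R)
    (nu_arc : forall (v u : T) (k : nat), (1 <= k)%N -> dist u v = k ->
      nu v (end_arc v u) = (1 / (q.+1%:R * q%:R ^+ k.-1))%:E)
    (t : R) (f : T -> R[i]) :
  ell1 f -> inversion_formula nu (horo_family (q := q) t) f.
Proof.
move=> f1 v.
have tl : forall e : R, 0 < e ->
    exists B, tail_le (fun u => ComplexField.Normc.normc (f u)) B e.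
  by apply: esum_tail => // u; exact: le_trans (norm_Re_le (f u)).
have Rei n := integral_horo_limit nu_arc (v := v) (n := n) tl
  (fun w B e tB => (radon_approx (horosphere n w v) tl tB).1).
have Imi n := integral_horo_limit nu_arc (v := v) (n := n) tl
  (fun w B e tB => (radon_approx (horosphere n w v) tl tB).2).
split; first by move=> n; split; [exact: (Rei n).1|exact: (Imi n).1].
have ReP := bilateral_cvg t (fun u => norm_Re_le (f u)) tl (fun n => (Rei n).2).
have ImP := bilateral_cvg t (fun u => norm_Im_le (f u)) tl (fun n => (Imi n).2).
apply: cvg_complex.
  apply: cvg_trans ReP; apply: near_eq_cvg; near=> MN => /=.
  rewrite raddfD /= !Re_sum; congr (_ + _); apply: eq_bigr => k _; by rewrite [RHS]Re_real_mul.
apply: cvg_trans ImP; apply: near_eq_cvg; near=> MN => /=.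
rewrite raddfD /= !Im_sum; congr (_ + _); apply: eq_bigr => k _; by rewrite [RHS]Im_real_mul.
Unshelve. all: by end_near. Qed.

Lemma finitely_supported_ell1 (R : realType) (q : nat) (T : homogeneousTree q)
  (f : T -> R[i]) : finitely_supported f -> ell1 f.
Proof.
move=> ffin; rewrite /ell1 /=.
rewrite (esumID [set u | f u != 0]); last first.
  by move=> u _; rewrite lee_fin; exact: le_trans (norm_Re_le (f u)).
rewrite setTI esum_fset //; last first.
  by move=> u _; rewrite lee_fin; exact: le_trans (norm_Re_le (f u)).
rewrite esum1 ?adde0 => [|u [_ /negP/negPn/eqP ->]]; last first.
  by rewrite ComplexField.Normc.normc0.
by rewrite fsbig_finite // sumEFin ltry.
Qed.

Theorem corollary3p2p2 (R : realType) (q : nat) (T : homogeneousTree q)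
  (nu : T -> probability (borel_ends T) R)
  (nu_arc : forall (v u : T) (k : nat), (1 <= k)%N -> dist u v = k ->
     nu v (end_arc v u) = (1 / (q.+1%:R * q%:R ^+ k.-1))%:E)
  (F : set (T -> R[i])) (hF : F = finitely_supported \/ F = ell1) :
  [/\ ~ countable [set d : int -> R |
          forall f, F f -> inversion_formula nu d f],
      forall f, F f -> inversion_formula nu (horo_coef1 R q) f
    & forall f, F f -> inversion_formula nu (horo_coef2 R q) f].
Proof.
have F1 f : F f -> ell1 f by case: hF => -> //; exact: finitely_supported_ell1.
have inv t f : F f -> inversion_formula nu (horo_family (q := q) t) f.
  by move=> /F1; exact: inversion_ell1.
split.
(* The injective family indexed by the reals lies in the set of suitable sequences. *)
- move=> cnt; have : countable (range (@horo_family R q)).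
    apply: sub_countable cnt; apply: subset_card_le => _ [t _ <-] f; exact: inv.
  have /eq_countable -> : (range (@horo_family R q) #= [set: R])%card.
    by apply: inj_card_eq => t t' _ _; exact: horo_family_inj.
  (* The reals are uncountable: a countable [0, 1] would have Lebesgue measure 0 instead of 1. *)
  move=> Rcnt; have : countable `[(0 : R), 1]%classic.
    by apply: sub_countable Rcnt; exact: subset_card_le.
  move=> /countable_lebesgue_measure0; rewrite lebesgue_measure_itv /= lte_fin ltr01.
  by rewrite oppr0 adde0 => -[/eqP]; rewrite oner_eq0.
- by rewrite -(horo_family0 (q := q)) => f; exact: inv.
- by rewrite -(horo_family1 (q := q)) => f; exact: inv.
Qed.
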